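(* Let $G$ be a group, let $p>2$ be a prime number and let $n>0$ be an integer such that $\gcd(n,p)=1$. Then $\Gamma_G\cong\Gamma_{\mathbb{Z}_p\oplus\mathbb{Z}_p\oplus\mathbb{Z}_p\oplus\mathbb{Z}_n}$ if and only if $G\cong\mathbb{Z}_p\oplus\mathbb{Z}_p\oplus\mathbb{Z}_p\oplus\mathbb{Z}_n$ or $G\cong T\times\mathbb{Z}_n$, where $T$ is the only (up to isomorphism) non-abelian group of order $p^3$ and exponent $p$.
   Context: A group is locally cyclic if each of its finitely generated subgroups is cyclic. For a group $G$, $Cyc(G)=\{x\in G : \langle x,y\rangle \text{ is cyclic for all } y\in G\}$. For a non locally cyclic group $G$, the non-cyclic graph $\Gamma_G$ is the simple graph with vertex set $G\setminus Cyc(G)$ in which two distinct vertices $x,y$ are adjacent if and only if $\langle x,y\rangle$ is not cyclic. $\Gamma_G\cong\Gamma_K$ means that $G$ and $K$ are non locally cyclic groups and the two graphs are isomorphic ($G$ is not assumed finite). $\mathbb{Z}_n$ is the cyclic group of order $n$. *)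

(* Defs.v *)
From mathcomp Require Import all_boot all_order all_algebra all_fingroup all_solvable.
From mathcomp Require Import boolp classical_sets cardinality.

Set Implicit Arguments.
Unset Strict Implicit.
Unset Printing Implicit Defensive.

Local Open Scope group_scope.
Local Open Scope classical_set_scope.

(* The groups here need not be finite, so that the theory of finite groups
   ([<<_>>], [cyclic], [isog]) is not available; subsets of a [groupType] are
   the Prop-valued sets of classical_sets. *)

Definition is_subgroup (G : groupType) (H : set G) : Prop :=
  H 1 /\ forall x y, H x -> H y -> H (x * y^-1).

Definition subgroup_gen (G : groupType) (S : set G) : set G :=
  smallest (@is_subgroup G) S.

Definition is_cyclic (G : groupType) (H : set G) : Prop :=
  exists z : G, H = subgroup_gen [set z].

Definition finitely_generated (G : groupType) (H : set G) : Prop :=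
  exists2 S : set G, finite_set S & H = subgroup_gen S.

Definition locally_cyclic (G : groupType) : Prop :=
  forall H : set G, finitely_generated H -> is_cyclic H.

Definition Cyc (G : groupType) : set G :=
  [set x | forall y : G, is_cyclic (subgroup_gen [set x; y])].

Definition group_iso (G K : groupType) : Prop :=
  exists f : {multiplicative G -> K}, bijective f.

Record simple_graph : Type := SimpleGraph {
  vertex :> Type;
  adj : vertex -> vertex -> Prop;
  adj_sym : forall x y, adj x y -> adj y x;
  adj_irrefl : forall x, ~ adj x x
}.

Definition graph_iso (A B : simple_graph) : Prop :=
  exists f : A -> B, bijective f /\ forall x y, adj x y <-> adj (f x) (f y).

Definition noncyclic_adj (G : groupType) (x y : ~` @Cyc G) : Prop :=
  x <> y /\ ~ is_cyclic (subgroup_gen [set val x; val y]).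

Lemma noncyclic_adj_sym (G : groupType) (x y : ~` @Cyc G) :
  noncyclic_adj x y -> noncyclic_adj y x.
Proof. by case=> xNy ncyc; split; [exact: nesym|rewrite setUC]. Qed.

Lemma noncyclic_adj_irrefl (G : groupType) (x : ~` @Cyc G) :
  ~ noncyclic_adj x x.
Proof. by case. Qed.

Definition noncyclic_graph (G : groupType) : simple_graph :=
  SimpleGraph (@noncyclic_adj_sym G) (@noncyclic_adj_irrefl G).

Definition noncyclic_graph_iso (G K : groupType) : Prop :=
  [/\ ~ locally_cyclic G, ~ locally_cyclic K &
      graph_iso (noncyclic_graph G) (noncyclic_graph K)].

(* For n > 0, the integers mod n under addition. ['Z_n] would be wrong for
   n = 1, where it has two elements. *)
Definition Zmod (n : nat) : finGroupType := 'I_n.-1.+1.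

Definition nonabelian_p3_exp_p (p : nat) (T : finGroupType) : Prop :=
  [/\ ~~ abelian [set: T]%SET, #|T| = (p ^ 3)%N & exponent [set: T]%SET = p].

(* Main.v *)
(* Cyc(G) is a central subgroup Z, and the non-cyclic graph of
   Z_p^3 x Z_n (or T x Z_n) is complete multipartite with N = p^2 + p + 1 parts
   of size (p - 1) n: the parts are (C \ 1) x Z_n for the subgroups C of order p.

   Conversely, suppose that the graph of G has this form. A translate of Z lies
   outside Z, so G is finite. Each part together with Z is a maximal cyclic
   subgroup, so G / Z is partitioned into N cyclic subgroups of the same order q,
   where (q - 1) |Z| = (p - 1) n and |G / Z| = 1 + N (q - 1).
   - q is prime: commuting elements in distinct parts have the same order, which
     for the largest prime t dividing q leaves a Sylow t-subgroup inside a part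
     unless q = t; in that case all parts are conjugate and N divides |G / Z|,
     which is absurd.
   - Thus G / Z has order q^m, and q^m = 1 + N (q - 1) with q and p odd primes
     forces q = p by a divisibility argument. The equation alone does not exclude
     q = 2 (2^5 = 1 + 31 with p = 5), but then |Z| = (p - 1) n is even, G has a
     unique involution, commuting elements outside Z agree modulo Z, and the
     commutator form on the elementary abelian 2-group G / Z would be nonzero on
     every pair of independent elements, which fails in dimension 3.
   - With q = p we get |Z| = n and G is the product of Z with a Sylow p-subgroup of
     order p^3 and exponent p. *)

From HB Require Import structures.
Require Import Defs.
From mathcomp Require Import all_boot all_order all_algebra all_fingroup all_solvable.
From mathcomp Require Import zify.

Set Implicit Arguments.
Unset Strict Implicit.
Unset Printing Implicit Defensive.


(** * A Diophantine equation between two odd primes *)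

(* This is (r^m - 1) / (r - 1) = p^2 + p + 1. The right-hand side is odd, so m is
   odd, say m = 2 k + 1, and p (p + 1) (r - 1) = r (r^k - 1) (r^k + 1). If p <> r,
   size excludes p | r^k - 1, so r^k + 1 = u p; then r divides both p + 1 and
   u + 1, which makes u too large. *)
Lemma prime_goormaghtigh (p r m : nat) : prime p -> 2 < p -> prime r -> odd r ->
  r ^ m = 1 + (p ^ 2 + p + 1) * r.-1 -> r = p.
Proof.
move=> p_pr p_gt2 r_pr r_odd def_rm.
have r_gt2 : 2 < r by rewrite odd_prime_gt2.
have N_odd : odd (p ^ 2 + p + 1) by rewrite !oddD oddX /=; case: (odd p).
have m_odd : odd m.
  (* For even [m], r^2 - 1 divides r^m - 1. As r + 1 is even, 2 (r - 1) then divides (p^2 + p + 1)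
     (r - 1), against [N_odd]. *)
  apply: contraTT N_odd => /even_halfK def_m; rewrite -dvdn2.
  have : 2 * r.-1 %| (p ^ 2 + p + 1) * r.-1.
    have -> : (p ^ 2 + p + 1) * r.-1 = (r ^ 2) ^ m./2 - 1 ^ m./2.
      by rewrite -expnM mul2n def_m exp1n; lia.
    rewrite subn_exp; apply: dvdn_mulr.
    rewrite -[1]/(1 ^ 2) subn_sqr subn1 addn1 mulnC dvdn_pmul2l; last lia.
    by rewrite dvdn2 /= r_odd.
  by rewrite dvdn_pmul2r; last lia.
pose X := r ^ m./2.
have def_X : r ^ m = r * X ^ 2.
  by rewrite -[m in LHS]odd_double_half m_odd add1n expnS -muln2 expnM.
have X_gt0 : 0 < X by rewrite expn_gt0 prime_gt0.
have eqN : p * (p + 1) * r.-1 = r * (X.-1 * (X + 1)).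
  have -> : X.-1 * (X + 1) = X ^ 2 - 1 by rewrite -[1 in RHS](exp1n 2) subn_sqr subn1.
  rewrite mulnBr -def_X def_rm muln1 -[r in _ - r]prednK ?prime_gt0 //.
  by rewrite -mulnn; lia.
have X1_gt0 : 0 < X.-1.
  by rewrite lt0n; apply/eqP => X1; move: eqN; rewrite X1 muln0; nia.
have p_dvd : p %| r * (X.-1 * (X + 1)) by rewrite -eqN -mulnA dvdn_mulr.
have r_dvd : r %| p * (p + 1).
  rewrite -(@Gauss_dvdl _ _ r.-1) ?eqN ?dvdn_mulr //.
  by rewrite -[r in coprime r]prednK ?prime_gt0 // coprimeSn.
move: p_dvd; rewrite Euclid_dvdM // dvdn_prime2 // => /orP[/eqP-> //|].
rewrite Euclid_dvdM // => /orP[p_dvd|/dvdnP[u def_u]].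
  have p_le := dvdn_leq X1_gt0 p_dvd.
  have le_pX : p * (p + 1) <= X.-1 * (X + 1) by rewrite leq_mul //; lia.
  suff: p * (p + 1) * r.-1 < r * (X.-1 * (X + 1)) by rewrite eqN ltnn.
  by rewrite mulnC (@leq_ltn_trans (r.-1 * (X.-1 * (X + 1)))) ?leq_mul2l ?le_pX ?orbT //
             ltn_mul2r muln_gt0 X1_gt0; lia.
move: r_dvd; rewrite Euclid_dvdM // => /orP[|r_dvd].
  by rewrite dvdn_prime2 // => /eqP.
have X_gt1 : 1 < X by lia.
have r_dvdX : r %| X.
  by move: X_gt1; rewrite /X; case: (m./2) => // k _; rewrite expnS dvdn_mulr.
have u_ge : r.-1 <= u.
  (* Here u (p + 1) = (X + 1) + u, and [r] divides both p + 1 and [X]. *)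
  have r_dvdu : r %| u + 1.
    have : r %| u * (p + 1) by apply: dvdn_mull.
    by rewrite mulnDr muln1 -def_u -addnA dvdn_addr // addnC.
  by have := dvdn_leq _ r_dvdu; lia.
(* With p + 1 = s r, [eqN] cancels to s (r - 1) = (X - 1) u, so X - 1 <= s <= (p + 1) / 3. But u >=
   2 gives X + 1 >= 2 p. *)
case/dvdnP: r_dvd => s def_s.
have p_gt0 : 0 < p by lia.
have eq_s : s * r.-1 = X.-1 * u.
  apply/eqP; rewrite -(@eqn_pmul2l (r * p)) ?muln_gt0 ?prime_gt0 //; apply/eqP.
  by rewrite def_u def_s in eqN; lia.
have le_Xs : X.-1 <= s.
  have : X.-1 * r.-1 <= s * r.-1 by rewrite eq_s leq_mul2l u_ge orbT.
  by rewrite leq_pmul2r //; lia.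
have : s * 3 <= p + 1 by rewrite def_s leq_mul2l r_gt2 orbT.
have : 2 * p <= X + 1 by rewrite def_u leq_mul2r; lia.
by lia.
Qed.

Local Open Scope group_scope.

(** * Partitions into cyclic subgroups of equal order *)

(** The components are all the cyclic subgroups of order [q], each given by a generator, so
    conjugation permutes them. *)
Definition cyclic_partition (gT : finGroupType) (q : nat) : Prop :=
  (forall x : gT, x != 1 -> exists2 a, #[a] = q & x \in <[a]>) /\
  (forall a b x : gT, #[a] = q -> #[b] = q -> x != 1 ->
     x \in <[a]> -> x \in <[b]> -> <[a]> = <[b]>).

(** The product [x * y] lies in a third component, which contains neither factor. Its power of
    exponent [#[y]] is [x ^+ #[y]], which lies both there and in [<[a]>], hence is 1; the other
    divisibility is symmetric. *)
Lemma cyclic_partition_commute (gT : finGroupType) (q : nat) (a x y : gT) :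
    cyclic_partition gT q -> #[a] = q -> x \in <[a]> -> y \notin <[a]> ->
    x != 1 -> commute x y -> #[x] = #[y].
Proof.
move=> [cover_q triv_q] oa xa y_a x_neq1 cxy.
have y_neq1 : y != 1 by apply: contraNneq y_a => ->; apply: group1.
have [b ob yb] := cover_q y y_neq1.
have xy_neq1 : x * y != 1.
  by apply: contraNneq y_a => /eqP; rewrite -eq_invg_mul => /eqP <-; rewrite groupV.
have [d od xyd] := cover_q _ xy_neq1.
have x_d : x \notin <[d]>.
  apply: contra y_a => xd; rewrite (triv_q a d x) //.
  by rewrite -(groupMl _ xd).
have y_d : y \notin <[d]>.
  apply: contra x_d => yd; by rewrite -(groupMr _ yd).
apply/eqP; rewrite eqn_dvd; apply/andP; split; rewrite order_dvdn.
  apply: contraNT x_d => xn; rewrite (triv_q d a (x ^+ #[y])) ?(groupX _ xa) //.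
  by rewrite -[x ^+ _]mulg1 -(expg_order y) -expgMn // groupX.
apply: contraNT y_d => yn; rewrite (triv_q d b (y ^+ #[x])) ?(groupX _ yb) //.
by rewrite -[y ^+ _]mul1g -(expg_order x) -expgMn // groupX.
Qed.

Lemma cyclic_partition_prime (gT : finGroupType) (q : nat) :
    cyclic_partition gT q -> (forall a : gT, exists y, y \notin <[a]>) -> prime q.
Proof.
move=> part_q noncyc; have [cover_q triv_q] := part_q.
have [x0] := noncyc 1; rewrite cycle1 inE => x0_neq1.
have [a0 oa0 x0a0] := cover_q _ x0_neq1.
have q_gt1 : (1 < q)%N.
  by rewrite -oa0 order_gt1; apply: contraNneq x0_neq1 => a1; rewrite a1 cycle1 inE in x0a0.
(* The largest prime is chosen so that any other prime [r] dividing [q] satisfies [r < t]; this is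
   used in the last case. *)
set t := max_pdiv q; have t_pr : prime t by rewrite max_pdiv_prime.
have t_q : t %| q by apply: max_pdiv_dvd.
have [T sylT] := Sylow_exists t [set: gT].
have tT := pHall_pgroup sylT.
have T_neq1 : T :!=: 1.
  rewrite -cardG_gt1 (card_Hall sylT) p_part_gt1 mem_primes t_pr cardG_gt0.
  by rewrite (dvdn_trans t_q) // -oa0 cardSg ?subsetT.
have [_ t_Z _] := pgroup_pdiv (pgroupS (center_sub T) tT)
  (contraNneq (fun Z1 => introT eqP (trivg_center_pgroup tT Z1)) T_neq1).
have [z zZ oz] := Cauchy t_pr t_Z.
have /centerP[zT cTz] := zZ.
have z_neq1 : z != 1 by rewrite -order_gt1 oz prime_gt1.
have [a oa za] := cover_q _ z_neq1.
(* Conjugation by [y] fixes [z], hence preserves the component of [z]. *)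
have TNa y : y \in T -> <[a]> :^ y = <[a]>.
  move=> yT; rewrite -cycleJ; apply: (triv_q _ _ z); rewrite ?orderJ //.
  have <- : z ^ y = z by rewrite conjgE (cTz y yT) mulKg.
  by rewrite cycleJ memJ_conjg.
have [sTa | /subsetPn[y yT y_a]] := boolP (T \subset <[a]>).
  (* Every component contains a Sylow t-subgroup, so all are conjugate. *)
  pose P := [set <[b]>^# | b in [set b : gT | #[b] == q]].
  have cardP : #|[set: gT]^#| = (#|P| * q.-1)%N.
    apply: card_uniform_partition.
      move=> _ /imsetP[b /[!inE]/eqP ob ->].
      by have := cardsD1 1 <[b]>; rewrite group1 -orderE ob => ->.
    apply/and3P; split.
    - rewrite eqEsubset; apply/andP; split.
        by apply/bigcupsP => _ /imsetP[b _ ->]; rewrite setSD ?subsetT.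
      apply/subsetP => x /[!inE]/andP[x_neq1 _]; have [b ob xb] := cover_q x x_neq1.
      apply/bigcupP; exists <[b]>^#; last by rewrite !inE x_neq1.
      by apply: imset_f; rewrite inE ob.
    - apply/trivIsetP => _ _ /imsetP[b /[!inE]/eqP ob ->] /imsetP[d /[!inE]/eqP od ->].
      apply: contraNT => /pred0Pn[x /andP[/[!inE]/andP[x_neq1 xb] /andP[_ xd]]].
      by rewrite (triv_q b d x).
    apply/imsetP => -[b /[!inE]/eqP ob /esym/eqP].
    rewrite setD_eq0 -[[set 1]]/(1%G : {set gT}) subG1 cycle_eq1.
    by rewrite -order_eq1 ob eqn_leq leqNgt q_gt1.
  have conjP : P = <[a]>^# :^: [set: gT].
    apply/setP => A; apply/imsetP/imsetP => -[b].
      rewrite inE => /eqP ob ->{A}.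
      have [S sylS] := Sylow_exists t <[b]>.
      have sylS' : t.-Sylow([set: gT]) S.
        rewrite pHallE subsetT /= (card_Hall sylS) -orderE ob -oa orderE -(card_Hall sylT).
        by rewrite -(card_Hall (pHall_subl sTa (subsetT _) sylT)).
      have [g _ defS] := Sylow_trans sylT sylS'.
      exists g => //; rewrite conjD1g -cycleJ; congr (_^#).
      apply: (triv_q _ _ (z ^ g)); rewrite ?orderJ ?conjg_eq1 //.
        by rewrite (subsetP (pHall_sub sylS)) // defS memJ_conjg.
      by rewrite cycleJ memJ_conjg.
    move=> _ ->; exists (a ^ b); first by rewrite inE orderJ oa.
    by rewrite cycleJ conjD1g.
  (* [#|P|] divides |G| as the size of a conjugacy class, and |G| = 1 + [#|P|] (q - 1). A single
     component contradicts [noncyc]. *)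
  have : #|P| %| 1.
    have P_dvd : #|P| %| #|[set: gT]|.
      by rewrite conjP card_conjugates dvdn_indexg.
    move: (P_dvd); rewrite [X in _ %| X](cardsD1 1) in_setT cardP dvdn_addl //.
    exact: dvdn_mulr.
  rewrite dvdn1 => /cards1P[X defP].
  have [y] := noncyc a; case/negP.
  have [->|y_neq1] := eqVneq y 1; first exact: group1.
  have [b ob yb] := cover_q y y_neq1.
  have inX d : #[d] = q -> <[d]>^# = X.
    move=> od; apply/set1P; rewrite -defP; apply: imset_f.
    by rewrite inE od.
  have : y \in <[b]>^# by rewrite !inE y_neq1.
  by rewrite inX // -(inX a) // !inE => /andP[].
have oy : #[y] = t.
  by rewrite -oz; apply/esym/(cyclic_partition_commute part_q oa) => //; apply: cTz.
(* If [q] is a power of [t], the whole group is a t-group and [z] is central in it. A generator [b]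
   of the component of [y] then commutes with [z], so q = [#[b]] = [#[z]] = t. *)
have [q_t | ] := boolP (t.-nat q).
  have defT : T :=: [set: gT].
    apply/eqP; rewrite eqEcard subsetT (card_Hall sylT) part_pnat_id ?leqnn //.
    apply/pgroupP => r r_pr /(Cauchy r_pr)[x _ ox].
    have [|b ob xb] := cover_q x; first by rewrite -order_gt1 ox prime_gt1.
    by rewrite (pnatP _ _ q_t) ?(ltnW q_gt1) // -ob -ox order_dvdG.
  have y_neq1 : y != 1 by rewrite -order_gt1 oy prime_gt1.
  have [b ob yb] := cover_q y y_neq1.
  rewrite -ob -(cyclic_partition_commute part_q oa za) ?oz //.
    by apply: contra y_a; rewrite -cycle_subG => /subsetP->.
  by apply: cTz; rewrite defT inE.
(* Otherwise a prime [r < t] divides [q], and the t-group [<[y]>] acts on the subgroup of order [r]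
   of [<[a]>]. The number of fixed points is r modulo t, so some nontrivial one commutes with [y]
   and has order [t], which cannot divide [r]. *)
rewrite /pnat (ltnW q_gt1) /= -has_predC => /hasP[r r_q]; rewrite !inE => r_t.
have {r_q} [r_pr r_q] : prime r /\ r %| q by move: r_q; rewrite mem_primes => /and3P[].
have r_lt : (r < t)%N.
  by rewrite ltn_neqAle r_t max_pdiv_max // mem_primes r_pr ltnW.
pose b := a ^+ (q %/ r).
have ob : #[b] = r by rewrite orderXdiv oa ?dvdn_div // divnA // mulKn // ltnW.
have sba : <[b]> \subset <[a]> by rewrite cycle_subG mem_cycle.
have yNb : <[y]> \subset 'N(<[b]>).
  rewrite cycle_subG; apply/normP/eqP.
  rewrite -cycleJ (eq_subG_cyclic (cycle_cyclic a)) //= -?orderE ?orderJ //.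
  by rewrite cycleJ -(TNa y yT) conjSg.
have acts_y : [acts <[y]>, on <[b]> | 'J] by rewrite astabsJ.
have y_t : t.-group <[y]> by rewrite /pgroup -orderE oy pnat_id.
have := pgroup_fix_mod y_t acts_y.
rewrite afixJ -orderE ob (modn_small r_lt) => def_r.
have /trivgPn[x /setIP[xb]] : 'C_<[b]>(<[y]>) != 1.
  rewrite -cardG_gt1 (leq_trans (prime_gt1 r_pr)) //= def_r; exact: leq_mod.
rewrite /= cent_cycle => /cent1P cxy x_neq1.
have ox : #[x] = t.
  by rewrite -oy; apply: (cyclic_partition_commute part_q oa (subsetP sba _ xb)).
have : t %| r by rewrite -ox -ob order_dvdG.
by rewrite dvdn_prime2 // eq_sym (negPf r_t).
Qed.

(** * Finite groups whose non-cyclic graph is complete multipartite *)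

(** As subgroups of cyclic groups are cyclic, this says that [x] and [y] generate a cyclic
    subgroup. *)
Definition cocyclic (gT : finGroupType) (x y : gT) : bool :=
  [exists z, (x \in <[z]>) && (y \in <[z]>)].

Lemma cocyclicP (gT : finGroupType) (x y : gT) :
  reflect (exists2 z, x \in <[z]> & y \in <[z]>) (cocyclic x y).
Proof.
by apply: (iffP existsP) => [[z /andP[xz yz]]|[z xz yz]]; exists z; rewrite ?xz.
Qed.

Lemma cocyclicxx (gT : finGroupType) (x : gT) : cocyclic x x.
Proof. by apply/cocyclicP; exists x; rewrite cycle_id. Qed.

Definition max_cycle (gT : finGroupType) (m : gT) : Prop :=
  forall x, m \in <[x]> -> <[x]> = <[m]>.

Lemma max_cycle_exists (gT : finGroupType) (x : gT) :
  exists2 m, max_cycle m & x \in <[m]>.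
Proof.
case: (@arg_maxnP gT x (fun m => x \in <[m]>) (fun m => #[m]) (cycle_id x)) => m xm max_m.
exists m => // d md; apply/esym/eqP; rewrite eqEcard cycle_subG md; apply: max_m.
by move: xm; apply: subsetP; rewrite cycle_subG.
Qed.

Lemma cocyclic_max_cycle (gT : finGroupType) (m x : gT) :
  max_cycle m -> cocyclic m x = (x \in <[m]>).
Proof.
move=> max_m; apply/cocyclicP/idP => [[z mz]|xm]; first by rewrite (max_m z mz).
by exists m => //; apply: cycle_id.
Qed.

Lemma cocyclicC (gT : finGroupType) (x y : gT) : cocyclic x y = cocyclic y x.
Proof. by apply: eq_existsb => z; rewrite andbC. Qed.

Definition cyc_core (gT : finGroupType) : {set gT} :=
  [set x | [forall y, cocyclic x y]].

(** Being cocyclic with a generator of a maximal cyclic subgroup is membership in it, and such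
    subgroups cover the group. So Cyc(G) is their intersection, which makes it a subgroup, central
    and cyclic. *)
Lemma cyc_coreP (gT : finGroupType) (x : gT) :
  reflect (forall m, max_cycle m -> x \in <[m]>) (x \in cyc_core gT).
Proof.
rewrite inE; apply: (iffP forallP) => [cyc_x m max_m | core_x y].
  by rewrite -cocyclic_max_cycle // cocyclicC.
by have [m max_m ym] := max_cycle_exists y; apply/cocyclicP; exists m; rewrite ?core_x.
Qed.

Lemma cyc_core_group_set (gT : finGroupType) : group_set (cyc_core gT).
Proof.
apply/group_setP; split=> [|x y /cyc_coreP cx /cyc_coreP cy].
  by apply/cyc_coreP => m _; apply: group1.
by apply/cyc_coreP => m max_m; rewrite groupM ?cx ?cy.
Qed.

Definition cyc_core_group (gT : finGroupType) : {group gT} :=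
  Group (cyc_core_group_set gT).

Lemma cyc_core_central (gT : finGroupType) (x y : gT) :
  x \in cyc_core gT -> commute x y.
Proof.
move=> /cyc_coreP cx; have [m max_m ym] := max_cycle_exists y.
exact: (centsP (cycle_abelian m)) (cx m max_m) _ ym.
Qed.

Lemma cyc_core_norm (gT : finGroupType) : 'N(cyc_core gT) = setT.
Proof.
apply/eqP; rewrite -subTset (subset_trans _ (cent_sub _)) //.
by apply/subsetP => y _; apply/centP => x xZ; apply/commute_sym/cyc_core_central.
Qed.

Lemma cyc_core_cyclic (gT : finGroupType) : cyclic (cyc_core gT).
Proof.
have [m max_m _] := max_cycle_exists (1 : gT).
apply: (@cyclicS _ <[m]>%G (cyc_core_group gT) _ (cycle_cyclic m)).
by apply/subsetP => x /cyc_coreP; exact.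
Qed.

Lemma notin_cyc_core_cycle (gT : finGroupType) (x d : gT) :
  x \in <[d]> -> x \notin cyc_core gT -> d \notin cyc_core gT.
Proof.
move=> xd; apply: contra => dZ.
have: <[d]> \subset cyc_core_group gT by rewrite cycle_subG.
by move/subsetP; apply.
Qed.

(* The complement of the non-cyclic graph is a disjoint union of N cliques of s vertices. *)
Definition uniform_cocyclic (gT : finGroupType) (N s : nat) : Prop :=
  [/\ forall x y z : gT, x \notin cyc_core gT -> y \notin cyc_core gT ->
        z \notin cyc_core gT -> cocyclic x y -> cocyclic y z -> cocyclic x z,
      forall x : gT, x \notin cyc_core gT ->
        #|[set y in ~: cyc_core gT | cocyclic x y]| = s &
      #|~: cyc_core gT| = (N * s)%N].

(** [<[m]>] is the disjoint union of Cyc(G) and the clique of [m]. *)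
Lemma uniform_cocyclic_order (gT : finGroupType) (N s : nat) (m : gT) :
    uniform_cocyclic gT N s -> max_cycle m -> m \notin cyc_core gT ->
  #[m] = (#|cyc_core gT| + s)%N.
Proof.
move=> [_ card_s _] max_m m_Z; rewrite -(card_s m m_Z) orderE.
have /setIidPr coreI : cyc_core gT \subset <[m]> by apply/subsetP => x /cyc_coreP; apply.
rewrite -(cardsID (cyc_core gT) <[m]>) coreI; congr addn; apply: eq_card => x.
by rewrite !inE cocyclic_max_cycle.
Qed.

(** Transitivity through [x] makes the two generators cocyclic, and maximality identifies their
    subgroups. *)
Lemma uniform_cocyclic_max (gT : finGroupType) (N s : nat) (m m' x : gT) :
    uniform_cocyclic gT N s -> max_cycle m -> max_cycle m' ->
    x \notin cyc_core gT -> x \in <[m]> -> x \in <[m']> -> <[m]> = <[m']>.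
Proof.
move=> [trans_c _ _] max_m max_m' x_Z xm xm'.
apply: max_m'; rewrite -cocyclic_max_cycle //.
apply: (trans_c _ x); rewrite ?(notin_cyc_core_cycle xm) ?(notin_cyc_core_cycle xm') //.
  by apply/cocyclicP; exists m; rewrite ?cycle_id.
by apply/cocyclicP; exists m'; rewrite ?cycle_id.
Qed.

(** The maximal cyclic subgroups map to the components of a cyclic partition of G / Z, with [q] the
    index of Z in each of them. Once [q] is prime, G / Z has exponent [q] and Cauchy's theorem makes
    its order a power of [q]. *)
Lemma uniform_cocyclic_quotient (gT : finGroupType) (N s : nat) :
    uniform_cocyclic gT N s -> (1 < N)%N -> (0 < s)%N ->
  exists2 q, prime q &
  [/\ s = (q.-1 * #|cyc_core gT|)%N, forall x : gT, x ^+ q \in cyc_core gT,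
      #|gT| = (#|cyc_core gT| * (1 + N * q.-1))%N & exists m, (1 + N * q.-1)%N = (q ^ m)%N].
Proof.
move=> unif N_gt1 s_gt0; have [_ _ card_cZ] := unif.
set Z := cyc_core_group gT; rewrite -[cyc_core gT]/(Z : {set gT}) in card_cZ *.
have memN x : x \in 'N(Z) by rewrite cyc_core_norm inE.
have nZ (A : {set gT}) : A \subset 'N(Z) by rewrite cyc_core_norm subsetT.
have Z_gt0 : (0 < #|Z|)%N by apply: cardG_gt0.
have [x0] : exists x0, x0 \in ~: Z.
  by apply/set0Pn; rewrite -card_gt0 card_cZ muln_gt0 (ltnW N_gt1).
rewrite inE => x0Z.
have sZm m : max_cycle m -> Z \subset <[m]>.
  by move=> max_m; apply/subsetP => x /cyc_coreP; apply.
have [q q_gt0 card_q] : exists2 q, (0 < q)%N & (q * #|Z| = #|Z| + s)%N.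
  have [m0 max_m0 x0m0] := max_cycle_exists x0.
  exists #|<[m0]> : Z|; first by apply: indexg_gt0.
  rewrite mulnC Lagrange ?sZm // -orderE (uniform_cocyclic_order unif) //.
  exact: notin_cyc_core_cycle x0m0 x0Z.
have order_q m : max_cycle m -> m \notin Z -> #[coset Z m] = q.
  move=> max_m m_Z; rewrite orderE -quotient_cycle // card_quotient //.
  apply/eqP; rewrite -(eqn_pmul2l Z_gt0) Lagrange ?sZm //.
  by rewrite -orderE (uniform_cocyclic_order unif) // mulnC card_q.
have def_s : s = (q.-1 * #|Z|)%N by rewrite -subn1 mulnBl card_q mul1n addKn.
have q_gt1 : (1 < q)%N.
  by move: s_gt0; rewrite def_s muln_gt0 => /andP[]; case: q {order_q def_s card_q q_gt0} => [|[]].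
have cardG : #|gT| = (#|Z| * (1 + N * q.-1))%N.
  by rewrite -(cardsC Z) card_cZ def_s; lia.
have cardQ : #|[set: coset_of Z]| = (1 + N * q.-1)%N.
  have <- : [set: gT] / Z = [set: coset_of Z].
    by apply/setP => xb; have [x _ ->] := cosetP xb; rewrite mem_quotient ?inE.
  apply/eqP; rewrite card_quotient // -(eqn_pmul2l Z_gt0) -cardG.
  by rewrite Lagrange ?subsetT ?cardsT.
have cover xb : xb != 1 -> exists m, [/\ max_cycle m, m \notin Z & xb \in <[coset Z m]>].
  have [x Nx ->] := cosetP xb => x_Z.
  have [m max_m xm] := max_cycle_exists x; exists m; split=> //.
    by apply: notin_cyc_core_cycle xm _; apply: contra x_Z => xZ; rewrite coset_id.
  by rewrite -quotient_cycle // mem_quotient.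
have expQ (xb : coset_of Z) : xb ^+ q = 1.
  have [->|/cover[m [max_m m_Z xm]]] := eqVneq xb 1; first exact: expg1n.
  by apply/eqP; rewrite -order_dvdn -(order_q m) // order_dvdG.
have max_of d : #[d] = q -> exists m, [/\ max_cycle m, m \notin Z & <[d]> = <[coset Z m]>].
  move=> od; have [|m [max_m m_Z dm]] := cover d; first by rewrite -order_gt1 od.
  exists m; split=> //; apply/eqP; rewrite eqEcard cycle_subG dm.
  by rewrite -!orderE od order_q /=.
(* [<[m]>] contains [Z], so it is the full preimage of its image. *)
have mem_max m x : max_cycle m -> coset Z x \in <[coset Z m]> -> x \in <[m]>.
  move=> max_m; rewrite -quotient_cycle // => xm.
  have nZm : Z <| <[m]> by rewrite /normal sZm ?nZ.
  by rewrite -(quotientGK nZm); apply: mem_morphpre.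
have part_q : cyclic_partition (coset_of Z) q.
  split=> [xb /cover[m [max_m m_Z xm]] | a b xb oa ob xb_neq1].
    by exists (coset Z m); rewrite ?order_q.
  have [m [max_m m_Z ->]] := max_of a oa; have [m' [max_m' m_Z' ->]] := max_of b ob.
  have [x Nx def_xb] := cosetP xb; rewrite def_xb => /mem_max xm /mem_max xm'.
  rewrite -!quotient_cycle // (uniform_cocyclic_max unif max_m max_m' _ (xm max_m) (xm' max_m')) //.
  by apply: contra xb_neq1 => xZ; rewrite def_xb coset_id.
have q_pr : prime q.
  (* No cyclic subgroup is all of G / Z: elements have order at most [q], while 1 + N (q - 1) > q
     for N > 1. *)
  apply: cyclic_partition_prime part_q _ => a; apply/existsP; apply: contraT.
  rewrite negb_exists => /forallP all_a.
  have : (#|[set: coset_of Z]| <= #[a])%N.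
    by apply/subset_leq_card/subsetP => y _; have := all_a y; rewrite negbK.
  rewrite cardQ leqNgt; case/negP; apply: (@leq_ltn_trans q).
    by apply: dvdn_leq; rewrite // order_dvdn expQ.
  have : (2 * q.-1 <= N * q.-1)%N by rewrite leq_mul2r N_gt1 orbT.
  by lia.
exists q => //; split=> // [x|].
  by apply: coset_idr; rewrite ?memN // morphX ?memN //=; apply: expQ.
have /p_natP[m ->] : q.-nat (1 + N * q.-1)%N; last by exists m.
rewrite -cardQ; apply/pgroupP => r r_pr /(Cauchy r_pr)[x _ ox].
have : r %| q by rewrite -ox order_dvdn expQ.
by rewrite dvdn_prime2.
Qed.

(** * Excluding [q = 2] *)

Lemma abelian_2group_cyclic (gT : finGroupType) (A : {group gT}) (u : gT) :
    2.-group A -> abelian A -> #[u] = 2 ->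
  (forall x, x \in A -> x ^+ 2 = 1 -> x \in <[u]>) -> cyclic A.
Proof.
move=> A2 abA ou sA2u; rewrite abelian_rank1_cyclic // (rank_pgroup A2) p_rank_abelian //.
have sOu : 'Ohm_1(A) \subset <[u]>.
  rewrite (OhmE 1 A2) gen_subG; apply/subsetP => x /LdivP[xA x2]; exact: sA2u.
have := cardSg sOu; rewrite -orderE ou => /(dvdn_leq_log 2)-> //.
Qed.

(** In the case q = 2 the cliques are the nontrivial cosets of Z. If |Z| were even, with involution
    u, then [x, y] = u whenever x and y are independent modulo Z. The bound on |G| supplies
    independent x, y, w, and [x, y w] = u u = 1 contradicts this. *)
Lemma uniform_cocyclic_index2 (gT : finGroupType) (N : nat) :
    uniform_cocyclic gT N #|cyc_core gT| ->
    (forall x : gT, x ^+ 2 \in cyc_core gT) ->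
    (4 * #|cyc_core gT| < #|gT|)%N ->
  odd #|cyc_core gT|.
Proof.
move=> unif sqZ ltZ; have [_ card_c _] := unif.
set Z := cyc_core_group gT; rewrite -[cyc_core gT]/(Z : {set gT}) in card_c sqZ ltZ *.
have cZ x y : x \in Z -> commute x y by apply: cyc_core_central.
have classZ x y : x \notin Z -> y \notin Z -> cocyclic x y -> y \in x *: Z.
  move=> xZ yZ cxy; suff -> : x *: Z = [set y in ~: Z | cocyclic x y] by rewrite in_set in_setC yZ.
  apply/eqP; rewrite eqEcard card_lcoset card_c // leqnn andbT.
  apply/subsetP => _ /lcosetP[z zZ ->]; rewrite in_set in_setC groupMr // xZ.
  have [m max_m xm] := max_cycle_exists x; apply/cocyclicP; exists m => //.
  by rewrite groupM //; move/cyc_coreP: zZ; apply.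
rewrite -[odd _]negbK; apply/negP => Zeven.
have [u uZ ou] : {u | u \in Z & #[u] = 2}.
  by apply: (@Cauchy _ 2 Z) => //; rewrite dvdn2.
(* A maximal cyclic subgroup containing [v] also contains [u], and a cyclic group has at most one
   subgroup of order 2. *)
have u_uniq v : v ^+ 2 = 1 -> v \in <[u]>.
  move=> v2; have [->|v_neq1] := eqVneq v 1; first exact: group1.
  have ov : #[v] = 2 by apply: nt_prime_order.
  have [m max_m vm] := max_cycle_exists v.
  rewrite -cycle_subG -(cardSg_cyclic (cycle_cyclic m)) ?cycle_subG // -?orderE ?ov ?ou //.
  by move/cyc_coreP: uZ; apply.
have commZ x y : x \notin Z -> y \notin Z -> commute x y -> y \in x *: Z.
  (* w ^+ k is a 2-element in the coset of w, because w ^+ 2 lies in Z. *)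
  move=> xZ yZ cxy; pose k := (#|Z|`_2^')%N.
  have k_odd : odd k by rewrite odd_2'nat part_pnat.
  have powZ w : w ^+ k \in w *: Z.
    rewrite -(odd_double_half k) k_odd expgS -mul2n expgM mem_lcoset mulKg.
    by rewrite groupX.
  have powN w : w \notin Z -> w ^+ k \notin Z.
    by have /lcosetP[z zZ ->] := powZ w; rewrite groupMr.
  have pow2 (w : gT) : 2.-elt (w ^+ k).
    apply: (@pnat_dvd _ (2 * #|Z|`_2)%N); last by rewrite pnatM part_pnat.
    rewrite order_dvdn -expgM mulnC -mulnA partnC // expgM.
    by rewrite expg_cardG.
  pose A := (<[x ^+ k]> <*> <[y ^+ k]>)%G.
  have cA : <[y ^+ k]> \subset 'C(<[x ^+ k]>).
    by rewrite cycle_subG /= cent_cycle; apply/cent1P/commuteX/commute_sym/commuteX/commute_sym.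
  have defA : A :=: <[x ^+ k]> * <[y ^+ k]> by rewrite /= cent_joinEr.
  have A2 : 2.-group A by rewrite defA pgroupM; apply/andP; split; apply: pow2.
  have abA : abelian A.
    by rewrite defA abelianM !cycle_abelian.
  have /cyclicP[d defd] := abelian_2group_cyclic A2 abA ou (fun x _ => u_uniq x).
  have : cocyclic (x ^+ k) (y ^+ k).
    by apply/cocyclicP; exists d; rewrite -defd -cycle_subG ?joing_subl ?joing_subr.
  move/classZ=> /(_ (powN x xZ) (powN y yZ)).
  have eqZ w : w ^+ k *: Z = w *: Z by apply/lcoset_eqP/powZ.
  by move/lcoset_eqP; rewrite !eqZ => /lcoset_eqP.
have commE x y : x \notin Z -> y \notin Z -> y \notin x *: Z -> [~ x, y] = u.
  move=> xZ yZ yxZ.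
  have cZxy : [~ x, y] \in Z.
    (* Since [y ^+ 2] is central, the commutator is a quotient of squares and so lies in [Z]. Being
       central, it satisfies [x, y]^2 = [x^2, y] = 1. *)
    have E : x ^+ 2 * y ^+ 2 * [~ x, y] = (x * y) ^+ 2.
      rewrite commgEl conjgE -mulgA (mulgA (y ^+ 2)) (cZ (y ^+ 2) x^-1) // !expgS !expg0 !mulg1.
      by rewrite !mulgA !mulgK.
    by rewrite -(groupMl _ (groupM (sqZ x) (sqZ y))) E.
  have : [~ x, y] \in <[u]>.
    by apply: u_uniq; rewrite -commXg; [apply/eqP/commgP/cZ | apply/commute_sym/cZ].
  rewrite cycle2g // !inE => /orP[/commgP/commZ|/eqP//].
  by move=> /(_ xZ yZ); rewrite (negPf yxZ).
have pick a b d : exists w, [/\ w \notin Z, w \notin a *: Z, w \notin b *: Z & w \notin d *: Z].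
  pose U := Z :|: (a *: Z :|: (b *: Z :|: d *: Z)).
  have [w wU] : exists w, w \notin U.
    apply/existsP; apply: contraLR ltZ; rewrite negb_exists -leqNgt => /forallP allU.
    have {allU} sU : [set: gT] \subset U by apply/subsetP => w _; have := allU w; rewrite negbK.
    rewrite -cardsT (leq_trans (subset_leq_card sU)) //.
    do 3!rewrite cardsU (leq_trans (leq_subr _ _)) // mulSn ?card_lcoset leq_add2l.
    by rewrite mul1n.
  by exists w; move: wU; rewrite !in_setU !negb_or => /and4P[].
have [x [xZ _ _ _]] := pick 1 1 1.
have [y [yZ yx _ _]] := pick x x x.
(* The last two conditions on [w] say that [y * w] lies neither in [Z] nor in [x *: Z]. *)
have [w [wZ wx wy wyx]] := pick x y^-1 (y^-1 * x).
have : commute x (y * w).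
  have cuw : u ^ w = u by apply/conjg_fixP/commgP/cZ.
  apply/commgP; rewrite commgMJ !commE // cuw.
  by rewrite -(expg_order u) ou expgS expg1.
have ywZ : y * w \notin Z by apply: contra wy; rewrite mem_lcoset invgK.
move/(commZ _ _ xZ ywZ); apply/negP; apply: contra wyx.
by rewrite !mem_lcoset invMg invgK mulgA.
Qed.

Lemma uniform_cocyclic_card (gT : finGroupType) (p n : nat) :
    prime p -> (2 < p)%N -> (0 < n)%N ->
    uniform_cocyclic gT (p ^ 2 + p + 1) (p.-1 * n) ->
  [/\ #|cyc_core gT| = n, #|gT| = (n * p ^ 3)%N &
      forall x : gT, x ^+ p \in cyc_core gT].
Proof.
move=> p_pr p_gt2 n_gt0 unif.
have N_gt1 : (1 < p ^ 2 + p + 1)%N by lia.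
have s_gt0 : (0 < p.-1 * n)%N by rewrite muln_gt0 n_gt0 andbT; lia.
have [q q_pr [eq_s expq cardG [m def_m]]] := uniform_cocyclic_quotient unif N_gt1 s_gt0.
have [q_odd|q_even] := boolP (odd q).
  have def_q : q = p by apply: (@prime_goormaghtigh p q m); rewrite // -def_m.
  have def_n : #|cyc_core gT| = n.
    by apply/esym/eqP; rewrite -(@eqn_pmul2l p.-1) ?eq_s ?def_q //; lia.
  split; rewrite -?def_q // cardG def_n; congr (_ * _)%N.
  by rewrite def_q; case: (p) p_gt2 => // k _; rewrite /= !expnS expn0; lia.
have def_q : q = 2 by case: (even_prime q_pr) q_even => // ->.
rewrite def_q /= mul1n muln1 in eq_s cardG expq.
rewrite eq_s in unif.
have p_odd : odd p by case: (even_prime p_pr) p_gt2 => // ->.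
have : odd #|cyc_core gT|.
  apply: (uniform_cocyclic_index2 unif expq).
  by rewrite cardG mulnC ltn_pmul2l -?eq_s //; lia.
by rewrite -eq_s oddM; case: (p) p_odd => // k /= /negPf->.
Qed.

(** * Group isomorphisms and the structure of G *)

Lemma group_iso_of_bij (G K : groupType) (f : G -> K) :
  {morph f : x y / x * y} -> bijective f -> group_iso G K.
Proof.
move=> fM bij_f.
pose h : {multiplicative G -> K} := HB.pack f (isMultiplicative.Build G K f fM).
by exists h.
Qed.

Lemma group_iso_sym (G K : groupType) : group_iso G K -> group_iso K G.
Proof.
move=> [f [g fK gK]]; apply: (@group_iso_of_bij _ _ g); last by exists f.
by move=> x y; apply: (can_inj fK); rewrite gmulfM !gK.
Qed.

Lemma group_iso_trans (G K L : groupType) :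
  group_iso G K -> group_iso K L -> group_iso G L.
Proof.
move=> [f bij_f] [g bij_g].
apply: (@group_iso_of_bij _ _ (g \o f)); last exact: bij_comp.
by move=> x y /=; rewrite !gmulfM.
Qed.

Lemma isog_group_iso (aT rT : finGroupType) :
  [set: aT] \isog [set: rT] -> group_iso aT rT.
Proof.
case/isogP => f injf imf; apply: (@group_iso_of_bij _ _ f).
  by move=> x y; rewrite morphM ?inE.
apply: inj_card_bij; first by move=> x y; apply: (injmP injf); rewrite inE.
by rewrite -!cardsT -imf card_injm // subsetT.
Qed.

(** The map (a, b) to f(a) g(b) is a morphism because [B] centralizes [A], injective because coprime
    orders give [A :&: B] trivial, and bijective by counting. *)
Lemma group_iso_dprod (gT aT bT : finGroupType) (A B : {group gT}) :
    [set: aT] \isog A -> [set: bT] \isog B ->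
    B \subset 'C(A) -> coprime #|A| #|B| -> #|gT| = (#|A| * #|B|)%N ->
  group_iso gT (aT * bT)%type.
Proof.
case/isogP => f injf imf /isogP[g injg img] cAB co_AB cardG.
have fA x : f x \in A by rewrite -imf mem_morphim ?inE.
have gB x : g x \in B by rewrite -img mem_morphim ?inE.
apply: group_iso_sym; apply: (@group_iso_of_bij _ _ (fun x => f x.1 * g x.2)).
  move=> x y; rewrite !morphM ?inE // !mulgA; congr (_ * _); rewrite -!mulgA; congr (_ * _).
  by apply/esym/(centsP cAB); rewrite ?fA ?gB.
apply: inj_card_bij; last by rewrite cardG card_prod -!cardsT -imf -img !card_injm.
move=> [x1 x2] [y1 y2] /= eq_xy.
have eq_a : (f y1)^-1 * f x1 = g y2 * (g x2)^-1.
  by rewrite -(mulgK (g x2) (f x1)) eq_xy -mulgA mulKg.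
have : (f y1)^-1 * f x1 \in A :&: B.
  by rewrite inE {2}eq_a !groupM ?groupV ?fA ?gB.
rewrite coprime_TIg // => /set1P a1; move: eq_a; rewrite a1 => /esym/eqP.
rewrite -eq_mulgV1 => /eqP eq_g; move/eqP: a1; rewrite -eq_mulVg1 => /eqP eq_f.
congr pair; [apply/esym; move: eq_f | apply/esym; move: eq_g].
  by move/(injmP injf); apply; rewrite inE.
by move/(injmP injg); apply; rewrite inE.
Qed.

Lemma Zmod_cyclic (n : nat) : cyclic [set: Zmod n].
Proof. rewrite [X in cyclic X]Zp_cycle; exact: cycle_cyclic. Qed.

(** A non-abelian group of order p^3 is extraspecial, and the exponent singles out [p^{1+2}]. This
    gives the uniqueness of T. *)
Lemma nonabelian_isog_pX1p2 (gT : finGroupType) (P : {group gT}) (p : nat) :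
    prime p -> ~~ abelian P -> #|P| = (p ^ 3)%N -> exponent P %| p ->
  P \isog [set: p^{1+2}].
Proof.
move=> p_pr nabP cardP expP; apply: isog_pX1p2 => //.
have pP : p.-group P by rewrite /pgroup cardP pnatX pnat_id.
by apply: (p3group_extraspecial pP nabP); rewrite cardP pfactorK.
Qed.

Lemma expg_pair (aT bT : groupType) (x : aT) (y : bT) (k : nat) :
  ((x, y) : aT * bT) ^+ k = (x ^+ k, y ^+ k).
Proof. by elim: k => // k IHk; rewrite !expgS IHk. Qed.

Lemma abelem_pair (aT bT : finGroupType) (p : nat) : prime p ->
    p.-abelem [set: aT] -> p.-abelem [set: bT] ->
  p.-abelem [set: (aT * bT)%type].
Proof.
move=> p_pr /(abelemP p_pr)[abA expA] /(abelemP p_pr)[abB expB].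
apply/(abelemP p_pr); split=> [|[a b] _]; last by rewrite expg_pair expA ?expB ?inE.
apply/centsP => -[a b] _ [c d] _.
by congr (_, _); [apply: (centsP abA) | apply: (centsP abB)]; rewrite inE.
Qed.

Lemma card_Zmod (n : nat) : (0 < n)%N -> #|Zmod n| = n.
Proof. by move=> n_gt0; rewrite card_ord prednK. Qed.

Lemma abelem_Zmod (p : nat) : prime p -> p.-abelem [set: Zmod p].
Proof.
move=> p_pr; apply/(abelemP p_pr); split=> [|x _].
  exact: cyclic_abelian (Zmod_cyclic p).
apply/eqP; rewrite -order_dvdn -[X in _ %| X](@card_Zmod p) ?prime_gt0 // -cardsT.
by rewrite order_dvdG ?inE.
Qed.

(** For x in a Sylow p-subgroup P, x^p lies in both P and Z, whose orders are coprime, so x^p = 1.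
    As Z is central and |G| = |P| |Z|, G is the direct product of P and Z, and P is classified by
    whether it is abelian. *)
Lemma uniform_cocyclic_group_iso (gT T : finGroupType) (p n : nat) :
    prime p -> (2 < p)%N -> (0 < n)%N -> coprime n p ->
    nonabelian_p3_exp_p p T ->
    uniform_cocyclic gT (p ^ 2 + p + 1) (p.-1 * n) ->
  group_iso gT (Zmod p * Zmod p * Zmod p * Zmod n)%type \/
  group_iso gT (T * Zmod n)%type.
Proof.
move=> p_pr p_gt2 n_gt0 co_np [nabT cardT expT] unif.
have [cardZ cardG expZ] := uniform_cocyclic_card p_pr p_gt2 n_gt0 unif.
set Z := cyc_core_group gT; rewrite -[cyc_core gT]/(Z : {set gT}) in cardZ expZ.
have isoZ : [set: Zmod n] \isog Z.
  by rewrite (isog_cyclic_card _ (Zmod_cyclic n)) cyc_core_cyclic /= cardZ cardsT card_Zmod.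
have [P sylP] := Sylow_exists p [set: gT].
have cardP : #|P| = (p ^ 3)%N.
  have p'n : p^'.-nat n by rewrite p'natE // -prime_coprime // coprime_sym.
  rewrite (card_Hall sylP) cardsT cardG partnM // ?expn_gt0 ?prime_gt0 // part_p'nat // mul1n.
  by rewrite part_pnat_id // pnatX pnat_id.
have co_PZ : coprime #|P| #|Z| by rewrite cardP cardZ coprimeXl // coprime_sym.
have expP x : x \in P -> x ^+ p = 1.
  move=> xP; apply/set1P; rewrite -[[set 1]](coprime_TIg co_PZ).
  by rewrite inE expZ groupX.
have cPZ : Z \subset 'C(P).
  by apply/centsP => x xZ y _; apply: cyc_core_central.
have cardPZ : #|gT| = (#|P| * #|Z|)%N by rewrite cardP cardZ mulnC.
have [abP | nabP] := boolP (abelian P); [left | right].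
  apply: (group_iso_dprod _ isoZ cPZ co_PZ cardPZ).
  have abelZp := abelem_Zmod p_pr.
  have abelZ := abelem_pair p_pr (abelem_pair p_pr abelZp abelZp) abelZp.
  rewrite (isog_abelem_card _ abelZ) cardP cardsT !card_prod !card_Zmod ?prime_gt0 //.
  by rewrite -mulnA mulnn -expnS eqxx andbT; apply/(abelemP p_pr).
apply: (group_iso_dprod _ isoZ cPZ co_PZ cardPZ).
apply: (isog_trans (nonabelian_isog_pX1p2 p_pr nabT _ _)); rewrite ?cardsT ?expT //.
rewrite isog_sym; apply: nonabelian_isog_pX1p2 => //.
exact/exponentP.
Qed.

(** * The graphs of the two candidate groups *)

(** For [g] a generator of Z_n, the Chinese remainder theorem makes every pair of a power of [d] and
    a power of [g] a power of [(d, g)]. *)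
Lemma cocyclic_pair_Zmod (A : finGroupType) (p n : nat) (a b : A) (i j : Zmod n) :
    coprime n p -> (0 < n)%N -> (forall x : A, x ^+ p = 1) ->
  @cocyclic (A * Zmod n)%type (a, i) (b, j) = cocyclic a b.
Proof.
move=> co_np n_gt0 expA; apply/cocyclicP/cocyclicP => [[[c k]]|[d /cycleP[k ->] /cycleP[l ->]]].
  move=> /cycleP[e def_a] /cycleP[f def_b]; exists c; apply/cycleP.
    by exists e; move: def_a; rewrite expg_pair => -[].
  by exists f; move: def_b; rewrite expg_pair => -[].
have /cyclicP[g defg] := Zmod_cyclic n.
have og : g ^+ n = 1.
  by apply/eqP; rewrite -order_dvdn orderE -defg cardsT card_Zmod.
have mem_dg k' (i' : Zmod n) : (d ^+ k', i') \in <[(d, g) : A * Zmod n]>.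
  have : i' \in <[g]> by rewrite -defg inE.
  case/cycleP=> t ->; apply/cycleP; exists (chinese p n k' t).
  rewrite expg_pair -(expg_mod _ (expA d)) -[in RHS](expg_mod (chinese _ _ _ _) (expA d)).
  rewrite -[g ^+ t](expg_mod _ og) -[g ^+ chinese _ _ _ _](expg_mod _ og).
  by rewrite chinese_modl ?chinese_modr // coprime_sym.
by exists (d, g); apply: mem_dg.
Qed.

Lemma cocyclic_exp_prime (A : finGroupType) (p : nat) (a b : A) :
    prime p -> (forall x : A, x ^+ p = 1) -> a != 1 -> b != 1 ->
  cocyclic a b = (b \in <[a]>).
Proof.
move=> p_pr expA a_neq1 b_neq1; apply/cocyclicP/idP => [[d ad bd]|ba].
  have oA (x : A) : x != 1 -> #[x] = p by move=> x_neq1; apply: nt_prime_order.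
  suff -> : <[a]> = <[d]> by [].
  have d_neq1 : d != 1 by apply: contraNneq a_neq1 => d1; rewrite d1 cycle1 inE in ad.
  by apply/eqP; rewrite eqEcard cycle_subG ad -!orderE !oA ?leqnn.
by exists a; rewrite ?cycle_id.
Qed.

(** Cyc is 1 x Z_n, the cliques are [<[a]>^#] x Z_n, and p^3 - 1 = (p^2 + p + 1) (p - 1). *)
Lemma uniform_cocyclic_exp_prime (A : finGroupType) (p n : nat) :
    prime p -> (0 < n)%N -> coprime n p -> #|A| = (p ^ 3)%N ->
    (forall x : A, x ^+ p = 1) ->
  uniform_cocyclic (A * Zmod n)%type (p ^ 2 + p + 1) (p.-1 * n).
Proof.
move=> p_pr n_gt0 co_np cardA expA.
have cocE := cocyclic_pair_Zmod _ _ _ _ co_np n_gt0 expA.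
have oA (x : A) : x != 1 -> #[x] = p by move=> x_neq1; apply: nt_prime_order.
have coreE (a : A) (i : Zmod n) : ((a, i) \in cyc_core (A * Zmod n)%type) = (a == 1).
  rewrite inE; apply/forallP/eqP => [core_a | -> [b j]]; last first.
    by rewrite cocE; apply/cocyclicP; exists b; rewrite ?group1 ?cycle_id.
  apply/eqP; apply: contraT => a_neq1.
  have /subsetPn[b _ ba] : ~~ ([set: A] \subset <[a]>).
    apply/negP => /subset_leq_card; rewrite cardsT cardA -orderE oA // leqNgt.
    by rewrite -[X in (X < _)%N]expn1 ltn_exp2l ?prime_gt1.
  have := core_a (b, i); rewrite cocE (cocyclic_exp_prime p_pr expA) ?(negPf ba) //.
  by apply: contraNneq ba => ->; apply: group1.
split.
- move=> [a i] [b j] [c k]; rewrite !coreE !cocE => a1 b1 c1.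
  rewrite !(cocyclic_exp_prime p_pr expA) // => ba; apply: subsetP.
  by rewrite cycle_subG.
- move=> [a i]; rewrite coreE => a1.
  transitivity #|setX <[a]>^# [set: Zmod n]|.
    apply: eq_card => -[b j]; rewrite in_set in_setC coreE cocE in_setX in_setT andbT !in_setD1.
    by have [//|b1] := eqVneq b 1; rewrite (cocyclic_exp_prime p_pr expA).
  rewrite cardsX cardsT card_Zmod //; congr (_ * n)%N.
  by have := cardsD1 1 <[a]>; rewrite group1 -orderE oA // => ->.
have -> : ~: cyc_core (A * Zmod n)%type = setX [set~ 1] [set: Zmod n].
  by apply/setP => -[a i]; rewrite in_setC coreE in_setX in_setT andbT !inE.
rewrite cardsX cardsT card_Zmod // cardsC1 cardA mulnA; congr (_ * n)%N.
by case: p p_pr {co_np cardA expA cocE oA coreE} => // k _; rewrite /= !expnS expn0; lia.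
Qed.

(** * Arbitrary groups and graphs *)

From mathcomp Require Import boolp classical_sets cardinality.

Local Open Scope classical_set_scope.

Lemma subgroup_gen_subgroup (G : groupType) (S : set G) :
  is_subgroup (subgroup_gen S).
Proof.
split=> [H [[H1 _]] //|x y Sx Sy H [H_sub sSH]].
by have [_ HM] := H_sub; apply: HM; [apply: Sx | apply: Sy].
Qed.

Lemma mem_subgroup_gen (G : groupType) (S : set G) (x : G) :
  S x -> subgroup_gen S x.
Proof. by move=> Sx H [_]; apply. Qed.

Lemma subgroup_gen_min (G : groupType) (S H : set G) :
  is_subgroup H -> S `<=` H -> subgroup_gen S `<=` H.
Proof. by move=> H_sub sSH x; apply. Qed.

Lemma is_subgroupV (G : groupType) (H : set G) (x : G) :
  is_subgroup H -> H x -> H x^-1.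
Proof. by move=> [H1 HM] Hx; rewrite -[x^-1]mul1g; apply: HM. Qed.

Lemma is_subgroupM (G : groupType) (H : set G) (x y : G) :
  is_subgroup H -> H x -> H y -> H (x * y).
Proof.
move=> H_sub Hx Hy; rewrite -[y]invgK; have [_ HM] := H_sub; apply: HM => //.
exact: is_subgroupV.
Qed.

Lemma is_subgroupX (G : groupType) (H : set G) (x : G) (k : nat) :
  is_subgroup H -> H x -> H (x ^+ k).
Proof.
move=> H_sub Hx; elim: k => [|k IHk]; first by case: H_sub.
by rewrite expgS; apply: is_subgroupM.
Qed.

Lemma subgroup_gen1P (G : groupType) (z x : G) :
  subgroup_gen [set z] x <-> exists k : nat, x = z ^+ k \/ x = z ^- k.
Proof.
split; last first.
  have Gz := @subgroup_gen_subgroup G [set z].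
  have zz : subgroup_gen [set z] z by apply: mem_subgroup_gen.
  have zk k : subgroup_gen [set z] (z ^+ k) by exact: is_subgroupX Gz zz.
  by case=> k [] ->; [exact: zk | exact: is_subgroupV Gz (zk k)].
(* The elements [z ^+ i * z ^- j] form a subgroup, and each reduces to a single power by comparing
   [i] and [j]. *)
move=> Gx; have [i [j ->]] : exists i j : nat, x = z ^+ i * z ^- j.
  apply: (subgroup_gen_min (H := [set x | exists i j : nat, x = z ^+ i * z ^- j])) Gx.
    split; first by exists 0, 0; rewrite expg0 invg1 mulg1.
    move=> _ _ [i [j ->]] [k [l ->]]; exists (i + l)%N, (k + j)%N.
    rewrite invgM invgK !expgD invgM -!mulgA; congr (_ * _); rewrite !mulgA; congr (_ * _).
    by apply/commuteX/commute_sym/commuteV/commuteX.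
  by move=> _ ->; exists 1%N, 0; rewrite expg1 expg0 invg1 mulg1.
have [le_ji|/ltnW le_ij] := leqP j i.
  by exists (i - j)%N; left; rewrite -{1}(subnK le_ji) expgD mulgK.
by exists (j - i)%N; right; rewrite -{1}(subnK le_ij) expgD invgM mulKVg.
Qed.

(** By Euclidean division, the least positive [m] with [z ^+ m] in [H] yields a generator; if there
    is none, [H] is trivial. *)
Lemma is_cyclic_sub (G : groupType) (H : set G) (z : G) :
  is_subgroup H -> H `<=` subgroup_gen [set z] -> is_cyclic H.
Proof.
move=> H_sub sHz.
have HX k x : x = z ^+ k \/ x = z ^- k -> H x -> H (z ^+ k).
  by move=> [] -> // /(is_subgroupV H_sub); rewrite invgK.
have [[k [k_gt0 Hk]]|noH] := pselect (exists k : nat, (0 < k)%N /\ H (z ^+ k)); last first.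
  exists 1; apply/seteqP; split=> [x Hx | x].
    have /subgroup_gen1P[[|k] def_x] := sHz _ Hx.
      by case: def_x => ->; rewrite ?expg0 ?invg1; apply: mem_subgroup_gen.
    by case: noH; exists k.+1; split=> //; apply: HX def_x Hx.
  by apply: subgroup_gen_min => // _ ->; case: H_sub => H1 _.
have ex_k : exists k, (0 < k)%N && `[< H (z ^+ k) >].
  by exists k; rewrite k_gt0; apply/asboolP.
have [m /andP[m_gt0 /asboolP Hm] min_m] := ex_minnP ex_k.
exists (z ^+ m); apply/seteqP; split=> [x Hx | ]; last first.
  by apply: subgroup_gen_min => // _ ->.
have /subgroup_gen1P[i def_x] := sHz _ Hx.
have Hi : H (z ^+ i) by apply: HX def_x Hx.
have m_i : (i %% m)%N = 0.
  apply/eqP; rewrite eqn0Ngt; apply/negP => im_gt0.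
  suff /min_m : (0 < i %% m)%N && `[< H (z ^+ (i %% m)) >] by rewrite leqNgt ltn_mod m_gt0.
  rewrite im_gt0; apply/asboolP; have [_ HM] := H_sub.
  have -> : z ^+ (i %% m) = z ^+ i * (z ^+ m ^+ (i %/ m))^-1;
    last by apply: HM => //; apply: is_subgroupX.
  by rewrite -expgM {2}(divn_eq i m) addnC mulnC expgD mulgK.
apply/subgroup_gen1P; exists (i %/ m)%N; rewrite -expgM mulnC.
by have := divn_eq i m; rewrite m_i addn0 => <-.
Qed.

(** * Cocyclic pairs and [Cyc] in an arbitrary group *)

Definition cocyclic_in (G : groupType) (x y : G) : Prop :=
  exists z, subgroup_gen [set z] x /\ subgroup_gen [set z] y.

Lemma is_cyclic_gen2 (G : groupType) (x y : G) :
  is_cyclic (subgroup_gen [set x; y]) <-> cocyclic_in x y.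
Proof.
split=> [[z def_z]|[z [zx zy]]].
  by exists z; rewrite -def_z; split; apply: mem_subgroup_gen; [left | right].
apply: (@is_cyclic_sub _ _ z); first exact: subgroup_gen_subgroup.
refine (subgroup_gen_min (subgroup_gen_subgroup _) _).
by move=> w [->|->].
Qed.

Lemma CycP (G : groupType) (x : G) : Cyc x <-> forall y, cocyclic_in x y.
Proof. by split=> Cx y; apply/is_cyclic_gen2; apply: Cx. Qed.

(** Given [y], some cyclic subgroup generated by [a] contains [x] and [y], and one generated by [b]
    contains [c] and [a]. The latter contains both [x * c^-1] and [y]. *)
Lemma Cyc_subgroup (G : groupType) : is_subgroup (@Cyc G).
Proof.
split; first by apply/CycP => y; exists y; split;
  [case: (@subgroup_gen_subgroup _ [set y]) | apply: mem_subgroup_gen].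
move=> x c /CycP Cx /CycP Cc; apply/CycP => y.
have [a [ax ay]] := Cx y; have [b [bc ba]] := Cc a.
have sab : subgroup_gen [set a] `<=` subgroup_gen [set b].
  by refine (subgroup_gen_min (subgroup_gen_subgroup _) _) => _ ->.
exists b; split; last exact: sab.
by have [_ HM] := @subgroup_gen_subgroup _ [set b]; apply: HM => //; apply: sab.
Qed.

Lemma not_locally_cyclic (G : groupType) (x : ~` @Cyc G) : ~ locally_cyclic G.
Proof.
move=> lcG; have := valP x; rewrite inE => Cx; apply: Cx => y; apply: lcG.
by exists [set val x; y] => //; exact: finite_set2.
Qed.

(** Distinctness is automatic, since an element is cocyclic with itself. *)
Lemma noncyclic_adjE (G : groupType) (x y : ~` @Cyc G) :
  noncyclic_adj x y <-> ~ cocyclic_in (val x) (val y).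
Proof.
split=> [[_ ncyc] /is_cyclic_gen2 //|ncyc]; split; last by move/is_cyclic_gen2.
move=> eq_xy; apply: ncyc; rewrite eq_xy; exists (val y).
by split; apply: mem_subgroup_gen.
Qed.

Lemma cocyclic_in_morph (G K : groupType) (f : G -> K) (x y : G) :
  {morph f : x y / x * y} -> cocyclic_in x y -> cocyclic_in (f x) (f y).
Proof.
move=> fM; have f1 : f 1 = 1 by apply: (mulgI (f 1)); rewrite -fM !mulg1.
have fX w k : f (w ^+ k) = f w ^+ k.
  by elim: k => [|k IHk]; rewrite ?expg0 // !expgS fM IHk.
have fV w : f w^-1 = (f w)^-1 by apply: (mulgI (f w)); rewrite -fM !mulgV.
have fz z w : subgroup_gen [set z] w -> subgroup_gen [set f z] (f w).
  move=> /subgroup_gen1P[k def_w]; apply/subgroup_gen1P; exists k.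
  by case: def_w => ->; [left | right]; rewrite ?fV fX.
by move=> [z [zx zy]]; exists (f z); split; apply: fz.
Qed.

(** * Graph isomorphisms *)

Lemma bijectiveP (A B : Type) (f : A -> B) :
  injective f -> (forall y, exists x, f x = y) -> bijective f.
Proof.
move=> injf surjf; pose g y := projT1 (cid (surjf y)).
have gK y : f (g y) = y by rewrite /g; case: cid.
by exists g => // x; apply: injf.
Qed.

Lemma graph_iso_sym (A B : simple_graph) : graph_iso A B -> graph_iso B A.
Proof.
move=> [f [[g fK gK] adj_f]]; exists g; split; first by exists f.
by move=> x y; rewrite adj_f !gK.
Qed.

Lemma graph_iso_trans (A B C : simple_graph) :
  graph_iso A B -> graph_iso B C -> graph_iso A C.
Proof.
move=> [f [bij_f adj_f]] [g [bij_g adj_g]]; exists (g \o f); split.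
  exact: bij_comp.
by move=> x y; rewrite adj_f adj_g.
Qed.

Lemma group_iso_graph_iso (G K : groupType) : group_iso G K ->
  graph_iso (noncyclic_graph G) (noncyclic_graph K).
Proof.
move=> [f [g fK gK]].
have gM : {morph g : x y / x * y} by move=> x y; apply: (can_inj fK); rewrite gmulfM !gK.
have coc_f x y : cocyclic_in x y <-> cocyclic_in (f x) (f y).
  split=> [|/(cocyclic_in_morph gM)]; last by rewrite !fK.
  by apply: cocyclic_in_morph => {}x {}y; apply: gmulfM.
have Cyc_f x : Cyc x <-> Cyc (f x).
  split=> /CycP Cx; apply/CycP => y; last by apply/coc_f.
  by rewrite -[y]gK; apply/coc_f.
have f_Cyc (x : ~` @Cyc G) : f (val x) \in ~` @Cyc K.
  by rewrite inE => /Cyc_f; have := valP x; rewrite inE.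
exists (fun x => SigSub (f_Cyc x)); split.
  apply: bijectiveP => [x y /(congr1 val)/(can_inj fK)/val_inj // | y].
  have gy : g (val y) \in ~` @Cyc G.
    by rewrite inE => /Cyc_f; rewrite gK; have := valP y; rewrite inE.
  by exists (SigSub gy); apply: val_inj; rewrite /= gK.
by move=> x y; rewrite /= !noncyclic_adjE coc_f.
Qed.

(** * Complete multipartite non-cyclic graphs *)

Lemma multipartite_sym (N s : nat) (x y : 'I_N * 'I_s) : x.1 <> y.1 -> y.1 <> x.1.
Proof. exact: nesym. Qed.

Lemma multipartite_irrefl (N s : nat) (x : 'I_N * 'I_s) : ~ (x.1 <> x.1).
Proof. exact. Qed.

Definition multipartite (N s : nat) : simple_graph :=
  SimpleGraph (@multipartite_sym N s) (@multipartite_irrefl N s).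

Lemma cocyclic_in_fin (gT : finGroupType) (x y : gT) :
  reflect (cocyclic_in x y) (cocyclic x y).
Proof.
have genE (z w : gT) : subgroup_gen [set z] w <-> w \in <[z]>.
  split=> [/subgroup_gen1P[k []->] | /cycleP[k ->]].
  - exact: mem_cycle.
  - by rewrite groupV mem_cycle.
  by apply/subgroup_gen1P; exists k; left.
apply: (iffP (cocyclicP x y)) => [[z /genE zx /genE zy] | [z [/genE zx /genE zy]]].
  by exists z.
by exists z.
Qed.

Lemma Cyc_fin (gT : finGroupType) (x : gT) : reflect (Cyc x) (x \in cyc_core gT).
Proof.
rewrite inE; apply: (iffP forallP) => [Cx | /CycP Cx y]; last exact/cocyclic_in_fin.
by apply/CycP => y; apply/cocyclic_in_fin.
Qed.

Lemma mem_Cyc_fin (gT : finGroupType) (x : gT) : (x \in ~` @Cyc gT) = (x \notin cyc_core gT).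
Proof.
apply/idP/idP => [/set_mem xC | xC]; first exact/Cyc_fin.
by apply/mem_set => /Cyc_fin; apply/negP.
Qed.

(** Outside Cyc(G) cocyclicity is an equivalence relation. Enumerating its [N] classes, and the [s]
    elements of each, gives the vertex map [g]. *)
Lemma uniform_cocyclic_graph (gT : finGroupType) (N s : nat) : (0 < s)%N ->
  uniform_cocyclic gT N s -> graph_iso (noncyclic_graph gT) (multipartite N s).
Proof.
move=> s_gt0 [trans_c card_c cardD]; apply: graph_iso_sym.
pose D := (~: cyc_core gT)%SET; pose P := equivalence_partition (@cocyclic gT) D.
have eqv : {in D & &, equivalence_rel (@cocyclic gT)}.
  move=> x y z /[!inE] xZ yZ zZ; split.
    exact: cocyclicxx.
  move=> cxy; apply/idP/idP; last by apply: trans_c cxy; rewrite ?inE.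
  by rewrite cocyclicC in cxy; apply: trans_c cxy; rewrite ?inE.
have partP : finset.partition P D by apply: equivalence_partitionP.
have cardA A : A \in P -> #|A| = s.
  by case/imsetP => x; rewrite inE => xZ ->; apply: card_c.
have cardP : #|P| = N.
  apply/eqP; rewrite -(eqn_pmul2r s_gt0) -cardD.
  by rewrite (card_uniform_partition cardA partP).
(* The default values of [nth], here and in [g], are never reached: there are exactly [N] classes,
   each of size [s]. *)
pose A (i : 'I_N) := nth finset.set0 (enum P) i.
have A_P i : A i \in P by rewrite -mem_enum mem_nth // -cardE cardP.
pose g (u : 'I_N * 'I_s) := nth 1 (enum (A u.1)) u.2.
have gA u : g u \in A u.1 by rewrite -mem_enum mem_nth // -cardE cardA.
have [coverP tiP _] := and3P partP.
have gD u : g u \in D by rewrite -(eqP coverP); apply/bigcupP; exists (A u.1).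
have cocE u v : cocyclic (g u) (g v) = (u.1 == v.1).
  rewrite -(pblock_equivalence_partition eqv (gD u) (gD v)) -/P (def_pblock tiP (A_P u.1) (gA u)).
  apply/idP/eqP => [gvA | ->]; last exact: gA.
  apply/val_inj/eqP; rewrite -(nth_uniq finset.set0 _ _ (enum_uniq P)) -?cardE ?cardP;
    try exact: ltn_ord.
  by rewrite -/(A _) -/(A _) -(def_pblock tiP (A_P _) gvA) (def_pblock tiP (A_P _) (gA v)).
have g_inj : injective g.
  move=> [i j] [i' j'] eq_g; have eq1 : i = i'.
    by apply/eqP; have := cocE (i, j) (i', j'); rewrite eq_g cocyclicxx.
  move: eq_g; rewrite {i}eq1 /g /= => /eqP.
  by rewrite nth_uniq ?enum_uniq -?cardE ?cardA // => /eqP/val_inj->.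
have imD : D = [set g u | u in [set: 'I_N * 'I_s]%SET]%SET.
  apply/esym/eqP; rewrite eqEcard; apply/andP; split.
    by apply/fintype.subsetP => _ /imsetP[u _ ->].
  by rewrite card_imset // cardsT card_prod !card_ord cardD.
have gC u : g u \in ~` @Cyc gT by rewrite mem_Cyc_fin; have := gD u; rewrite inE.
exists (fun u => SigSub (gC u)); split.
  apply: bijectiveP => [u v /(congr1 val)/g_inj // | y].
  have : val y \in D by rewrite inE -mem_Cyc_fin (valP y).
  by rewrite imD => /imsetP[u _ def_y]; exists u; apply: val_inj.
move=> u v; rewrite /= noncyclic_adjE /=; split=> [ne_uv /cocyclic_in_fin | ncoc eq_uv].
  by rewrite cocE => /eqP.
by apply/ncoc/cocyclic_in_fin; rewrite cocE eq_uv.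
Qed.

(** On vertices, cocyclicity becomes equality of part indices, hence is transitive; the counts are
    transported along the injection [val \o g]. *)
Lemma graph_uniform_cocyclic (gT : finGroupType) (N s : nat) :
  graph_iso (noncyclic_graph gT) (multipartite N s) -> uniform_cocyclic gT N s.
Proof.
move=> [f [[g fK gK] adj_f]].
have cocE x y : cocyclic (val x) (val y) = ((f x).1 == (f y).1).
  have := adj_f x y; rewrite /= noncyclic_adjE => adjE.
  apply/cocyclic_in_fin/eqP => [coc|eq_f]; apply: contrapT.
    by move/adjE; apply.
  by move/adjE; apply.
have sub x : x \notin cyc_core gT -> exists y : ~` @Cyc gT, val y = x.
  by rewrite -mem_Cyc_fin => xC; exists (SigSub xC).
have valN (y : ~` @Cyc gT) : val y \notin cyc_core gT by rewrite -mem_Cyc_fin (valP y).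
have vg_inj : injective (val \o g) by apply: inj_comp val_inj (can_inj gK).
split.
- move=> _ _ _ /sub[x <-] /sub[y <-] /sub[z <-].
  by rewrite !cocE => /eqP-> /eqP->.
- move=> _ /sub[x <-].
  transitivity #|[set (val \o g) u | u in finset.setX [set (f x).1] [set: 'I_s]]%SET|.
    apply: eq_card => y; rewrite finset.in_set finset.in_setC; apply/andP/imsetP.
      case=> /sub[{}y <-]; rewrite cocE => /eqP eq_f; exists (f y); last by rewrite /= fK.
      by rewrite !inE eq_f eqxx.
    case=> u u_in ->.
    have {u_in}/eqP eq_f : u.1 == (f x).1 by move: u_in; rewrite !inE andbT.
    by split; [exact: valN | rewrite /= cocE gK eq_f].
  by rewrite card_imset // cardsX cards1 cardsT card_ord mul1n.
transitivity #|[set (val \o g) u | u in [set: 'I_N * 'I_s]]%SET|.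
  apply: eq_card => y; rewrite finset.in_setC; apply/idP/imsetP => [/sub[{}y <-] | [u _ ->]].
    by exists (f y); rewrite ?inE //= fK.
  exact: valN.
by rewrite card_imset // cardsT card_prod !card_ord.
Qed.

(** There are finitely many vertices. For a vertex [x0], the translate of the subgroup Cyc(G) by
    [x0] consists of vertices, so Cyc(G) is finite as well. *)
Lemma multipartite_finite (G : groupType) (N s : nat) : (0 < N)%N -> (0 < s)%N ->
    graph_iso (noncyclic_graph G) (multipartite N s) ->
  exists gT : finGroupType, group_iso G gT.
Proof.
move=> N_gt0 s_gt0 [f [[g fK gK] _]].
pose x0 := val (g (Ordinal N_gt0, Ordinal s_gt0)).
have x0C : ~ Cyc x0 by have := valP (g (Ordinal N_gt0, Ordinal s_gt0)); rewrite inE.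
pose L := [seq val (g u) | u <- enum (('I_N * 'I_s)%type : finType)].
have memL x : ~ Cyc x -> x \in L.
  move=> xC; have {}xC : x \in ~` @Cyc G by rewrite inE.
  by apply/mapP; exists (f (SigSub xC)); rewrite ?mem_enum // fK.
pose s' := L ++ [seq x0^-1 * y | y <- L].
have mem_s x : x \in s'.
  rewrite mem_cat; have [Cx|xC] := pselect (Cyc x); last by rewrite memL.
  apply/orP; right; apply/mapP; exists (x0 * x); last by rewrite mulKg.
  apply: memL => Cx0x; apply: x0C; rewrite -[x0](mulgK x).
  by have [_ CM] := Cyc_subgroup G; apply: CM.
(* [G] itself receives a finite structure, an element being encoded by its index in [s']. Its group
   law is kept, so the identity is the isomorphism. *)
pose unpickle i := if (i < size s')%N then Some (nth 1 s' i) else None.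
have pickleK : pcancel (fun x => index x s') unpickle.
  by move=> x; rewrite /unpickle index_mem mem_s nth_index.
have enumP : Finite.axiom (undup s').
  by move=> x; rewrite count_uniq_mem ?undup_uniq // mem_undup mem_s.
pose cT := isCountable.Build G pickleK.
pose gT : finGroupType := HB.pack (Group.sort G) (Group.class G) cT (isFinite.Build G enumP).
exists gT; apply: (@group_iso_of_bij G gT id); first by [].
by exists id.
Qed.

(** * Existence of T and the equivalence *)

Lemma pX1p2_nonabelian_p3_exp_p (p : nat) : prime p -> odd p ->
  nonabelian_p3_exp_p p (Pextraspecial.gtype p).
Proof.
move=> p_pr p_odd; have cardT := card_pX1p2 p_pr; split.
- exact: extraspecial_nonabelian (pX1p2_extraspecial p_pr).
- by rewrite -cardsT.
have [_ /(_ _ (exponent_pX1p2 p_pr p_odd))/orP[] /eqP // exp1] := primeP p_pr.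
have : [set: p^{1+2}]%SET == 1%g by rewrite trivg_exponent exp1.
by rewrite trivg_card1 cardT -(expn0 p) eqn_exp2l ?prime_gt1.
Qed.

Lemma noncyclic_graph_multipartite (A : finGroupType) (p n : nat) :
    prime p -> (0 < n)%N -> coprime n p -> #|A| = (p ^ 3)%N ->
    (forall x : A, x ^+ p = 1) ->
  graph_iso (noncyclic_graph (A * Zmod n)%type) (multipartite (p ^ 2 + p + 1) (p.-1 * n)).
Proof.
move=> p_pr n_gt0 co_np cardA expA; apply: uniform_cocyclic_graph.
  by rewrite muln_gt0 n_gt0 andbT -ltnS prednK ?prime_gt0 ?prime_gt1.
exact: uniform_cocyclic_exp_prime.
Qed.

Lemma multipartite_not_locally_cyclic (G : groupType) (N s : nat) :
    (0 < N)%N -> (0 < s)%N ->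
  graph_iso (noncyclic_graph G) (multipartite N s) -> ~ locally_cyclic G.
Proof.
move=> N_gt0 s_gt0 [f [[g _ _] _]].
exact: not_locally_cyclic (g (Ordinal N_gt0, Ordinal s_gt0)).
Qed.

Theorem proposition7p11 (G : groupType) (p n : nat)
  (p_prime : prime p) (p_gt2 : (2 < p)%N) (n_gt0 : (0 < n)%N)
  (co_np : coprime n p) :
  exists T : finGroupType,
    [/\ nonabelian_p3_exp_p p T,
        forall T' : finGroupType, nonabelian_p3_exp_p p T' -> group_iso T' T &
        noncyclic_graph_iso G (Zmod p * Zmod p * Zmod p * Zmod n)%type
        <->
        group_iso G (Zmod p * Zmod p * Zmod p * Zmod n)%type \/
        group_iso G (T * Zmod n)%type].
Proof.
have p_odd : odd p by case: (even_prime p_prime) p_gt2 => // ->.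
pose T : finGroupType := Pextraspecial.gtype p.
have T_p3 : nonabelian_p3_exp_p p T by apply: pX1p2_nonabelian_p3_exp_p.
exists T; split=> // [T' [nabT' cardT' expT']|].
  apply/isog_group_iso/nonabelian_isog_pX1p2 => //; first by rewrite cardsT.
  by rewrite expT'.
pose K : finGroupType := (Zmod p * Zmod p * Zmod p * Zmod n)%type.
(* [M] is the graph of both candidates, so both directions compare the graph of [G] with [M]. *)
pose M := multipartite (p ^ 2 + p + 1) (p.-1 * n).
have N_gt0 : (0 < p ^ 2 + p + 1)%N by rewrite addn1.
have s_gt0 : (0 < p.-1 * n)%N.
  by rewrite muln_gt0 n_gt0 andbT -ltnS prednK ?prime_gt0 ?prime_gt1.
have KM : graph_iso (noncyclic_graph K) M.
  apply: noncyclic_graph_multipartite => // [|x].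
    by rewrite !card_prod !card_Zmod ?prime_gt0 // -mulnA mulnn -expnS.
  have abelZ := abelem_Zmod p_prime.
  have /(abelemP p_prime)[_ expK] := abelem_pair p_prime (abelem_pair p_prime abelZ abelZ) abelZ.
  by apply: expK; rewrite inE.
have TM : graph_iso (noncyclic_graph (T * Zmod n)%type) M.
  have [_ cardT expT] := T_p3.
  apply: noncyclic_graph_multipartite => // x.
  by apply: (@exponentP _ [set: T] p); rewrite ?expT ?inE.
have lcM H := @multipartite_not_locally_cyclic H _ _ N_gt0 s_gt0.
split=> [[_ _ GK]|isoG].
  have GM := graph_iso_trans GK KM.
  have [gT G_gT] := multipartite_finite N_gt0 s_gt0 GM.
  have gTM := graph_iso_trans (graph_iso_sym (group_iso_graph_iso G_gT)) GM.
  have [] := uniform_cocyclic_group_iso p_prime p_gt2 n_gt0 co_np T_p3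
    (graph_uniform_cocyclic gTM); [left | right]; exact: group_iso_trans G_gT _.
have GM : graph_iso (noncyclic_graph G) M.
  by case: isoG => /group_iso_graph_iso GH; apply: graph_iso_trans GH _.
split; [exact: lcM GM | exact: lcM KM | exact: graph_iso_trans GM (graph_iso_sym KM)].
Qed.
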